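(* Let $d\ge 1$, $0\le \ell\le L$ be integers, and let $r:=2^{L-\ell}$. With $C_L$, $S_\ell$, $D_\ell$ and $E_{\ell\to L}$ the matrices defined in the context, $$C_L S_\ell = T_{\ell\to L}\,D_\ell,\qquad\text{where}\qquad T_{\ell\to L}:=r^{-d/2}\,E_{\ell\to L}.$$
   Context: Grids: $h_\ell:=2^{-\ell}$ for $\ell=0,\dots,L$, and $h:=h_L$. The space of interior grid functions on level $\ell$ is $V_\ell=\mathbb{R}^{(2^\ell-1)^d}\cong(\mathbb{R}^{2^\ell-1})^{\otimes d}$, indexed by $\{1,\dots,2^\ell-1\}^d$. One-dimensional difference operator: for $\bm u=(u_1,\dots,u_{2^\ell-1})^\top$, extended by $u_0=u_{2^\ell}=0$, the matrix $D_\ell^{1d}\in\mathbb{R}^{2^\ell\times(2^\ell-1)}$ is given by $(D_\ell^{1d}\bm u)_j=u_{j+1}-u_j$, $j=0,\dots,2^\ell-1$. Directional and stacked differences: $D_\ell^{(k)}:=I^{\otimes(k-1)}\otimes D_\ell^{1d}\otimes I^{\otimes(d-k)}$ for $k=1,\dots,d$, with $I$ the identity of size $2^\ell-1$; $D_\ell:=[(D_\ell^{(1)})^\top,\dots,(D_\ell^{(d)})^\top]^\top$ (vertical stacking). $C_L:=h^{d/2-1}D_L$. Prolongation: the one-step prolongation $P^{1d}_{\ell\to\ell+1}\in\mathbb{R}^{(2^{\ell+1}-1)\times(2^\ell-1)}$ maps $\bm v$ to $\bm w$ with $w_{2q}=v_q$ ($q=1,\dots,2^\ell-1$) and $w_{2q-1}=\tfrac12(v_{q-1}+v_q)$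 ($q=1,\dots,2^\ell$), where $v_0=v_{2^\ell}=0$. $P_\ell^{1d}:=P^{1d}_{L-1\to L}P^{1d}_{L-2\to L-1}\cdots P^{1d}_{\ell\to\ell+1}$ (the identity if $\ell=L$), $P_\ell:=(P_\ell^{1d})^{\otimes d}$, and $S_\ell:=h_\ell^{(2-d)/2}P_\ell$. Inter-level operator: with $r=2^{L-\ell}$, $E^{(1d)}_{\ell\to L}:=I_{2^\ell\times 2^\ell}\otimes\mathbf 1_r$, where $\mathbf 1_r$ is the column vector of $r$ ones. For $k=1,\dots,d$, $$E^{(k)}_{\ell\to L}:=\Big(\bigotimes_{m=1}^{k-1}P_\ell^{1d}\Big)\otimes E^{(1d)}_{\ell\to L}\otimes\Big(\bigotimes_{m=k+1}^{d}P_\ell^{1d}\Big),$$ and $E_{\ell\to L}:=\mathrm{diag}(E^{(1)}_{\ell\to L},\dots,E^{(d)}_{\ell\to L})$ (block diagonal). *)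

(* Defs.v *)
From mathcomp Require Import all_boot all_order all_algebra.
From mathcomp Require Import reals exp.
From mathcomp Require Import mxtens.

Set Implicit Arguments.
Unset Strict Implicit.
Unset Printing Implicit Defensive.

Import GRing.Theory.
Local Open Scope ring_scope.

(* The interior nodes 1, ..., 2^l - 1 of level l are numbered from 0 in
   MathComp: the index i : 'I_(2 ^ l - 1) stands for the node i + 1.  Grid
   functions in d dimensions are the column vectors of size
   (2 ^ l - 1) ^ d = nnode l ^ d, in the (lexicographic) order of the Kronecker
   product *t and the Kronecker power ^t of mxtens. *)
Definition nnode (l : nat) : nat := (2 ^ l - 1)%N.

Section Multilevel.
Variable R : realType.

Definition meshsize (l : nat) : R := (2 ^+ l)^-1.

(* The value u_q of u at the node q, extended by 0 outside 1, ..., n, and the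
   row vector of the linear form u |-> u_q. *)
Definition nodeval (n : nat) (u : 'cV[R]_n) (q : nat) : R :=
  \sum_(i < n | i.+1 == q) u i 0.

Definition nodeform (n q : nat) : 'rV[R]_n := \row_i (i.+1 == q)%:R.

Definition diff1d (l : nat) : 'M[R]_(2 ^ l, nnode l) :=
  \matrix_(j < 2 ^ l) (nodeform (nnode l) j.+1 - nodeform (nnode l) j).

(* For a fine node p = i.+1, uphalf p is q both when p = 2q and when
   p = 2q - 1. *)
Definition prol1 (l : nat) : 'M[R]_(nnode l.+1, nnode l) :=
  \matrix_(i < nnode l.+1)
    (let q := uphalf i.+1 in
     if odd i.+1
     then 2^-1 *: (nodeform (nnode l) q.-1 + nodeform (nnode l) q)
     else nodeform (nnode l) q).

Lemma nodeformP n q (u : 'cV[R]_n) : (nodeform n q *m u) 0 0 = nodeval u q.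
Proof.
rewrite mxE /nodeval [RHS]big_mkcond; apply: eq_bigr => i _; rewrite mxE.
by case: ifP; rewrite ?mul1r ?mul0r.
Qed.

Lemma nodeval_in n (u : 'cV[R]_n) (i : 'I_n) : nodeval u i.+1 = u i 0.
Proof. by rewrite /nodeval (big_pred1 i). Qed.

Lemma nodeval_out n (u : 'cV[R]_n) q :
  (q == 0) || (n < q)%N -> nodeval u q = 0.
Proof.
move=> hq; rewrite /nodeval big_pred0 // => i; apply/negP => /eqP iq.
by move: hq; rewrite -iq /= ltnS leqNgt ltn_ord.
Qed.

Lemma diff1dP l (u : 'cV[R]_(nnode l)) (j : 'I_(2 ^ l)) :
  (diff1d l *m u) j 0 = nodeval u j.+1 - nodeval u j.
Proof.
rewrite -!nodeformP !mxE -sumrB; apply: eq_bigr => i _.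
by rewrite !mxE mulrBl.
Qed.

Lemma prol1_even l (v : 'cV[R]_(nnode l)) q :
  (0 < q <= nnode l)%N -> nodeval (prol1 l *m v) q.*2 = nodeval v q.
Proof.
case: q => // q /= hq.
have hi : (q.*2.+1 < nnode l.+1)%N.
  move: hq; rewrite /nnode expnS mul2n !subn1 !ltn_predRL.
  by rewrite -doubleS ltn_double.
rewrite doubleS -[q.*2.+2]/((Ordinal hi).+1) nodeval_in -nodeformP !mxE.
by apply: eq_bigr => i _; rewrite !mxE /= odd_double uphalf_double mxE.
Qed.

Lemma prol1_odd l (v : 'cV[R]_(nnode l)) q :
  (0 < q <= 2 ^ l)%N ->
  nodeval (prol1 l *m v) q.*2.-1 = 2^-1 * (nodeval v q.-1 + nodeval v q).
Proof.
case: q => // q /= hq.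
have hi : (q.*2 < nnode l.+1)%N.
  by rewrite /nnode expnS mul2n subn1 ltn_predRL ltn_Sdouble.
rewrite -[q.*2.+1]/((Ordinal hi).+1) nodeval_in -!nodeformP !mxE -big_split /=.
rewrite mulr_sumr; apply: eq_bigr => i _.
by rewrite !mxE /= odd_double /= doubleK !mxE -mulrDl mulrA.
Qed.

Fixpoint prolk (l k : nat) : 'M[R]_(nnode (k + l), nnode l) :=
  if k is k'.+1 then prol1 (k' + l) *m prolk l k' else 1%:M.

Definition prol1d (l L : nat) (hl : (l <= L)%N) : 'M[R]_(nnode L, nnode l) :=
  castmx (congr1 nnode (subnK hl), erefl) (prolk l (L - l)).

Lemma dir_size (n d : nat) (k : 'I_d) :
  (n ^ k * n * n ^ (d - k.+1) = n ^ d)%N.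
Proof. by rewrite -expnSr -expnD subnKC. Qed.

(* Directions are numbered from 0 too: k : 'I_d stands for k + 1. *)
Definition nrow (d l : nat) (k : 'I_d) : nat :=
  (nnode l ^ k * 2 ^ l * nnode l ^ (d - k.+1))%N.

Definition diffdir (d l : nat) (k : 'I_d) :
    'M[R]_(nrow l k, nnode l ^ d) :=
  castmx (erefl, dir_size (nnode l) k)
    ((1%:M ^t k) *t diff1d l *t (1%:M ^t (d - k.+1))).

Definition Dmx (d l : nat) : 'M[R]_(\sum_(k < d) nrow l k, nnode l ^ d) :=
  \mxcol_(k < d) diffdir l k.

Definition Cmx (d L : nat) : 'M[R]_(\sum_(k < d) nrow L k, nnode L ^ d) :=
  (meshsize L `^ (d%:R / 2 - 1)) *: Dmx d L.

Definition Smx (d l L : nat) (hl : (l <= L)%N) :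
    'M[R]_(nnode L ^ d, nnode l ^ d) :=
  (meshsize l `^ ((2 - d%:R) / 2)) *: (prol1d hl ^t d).

Lemma pow2_split (l L : nat) : (l <= L)%N -> (2 ^ l * 2 ^ (L - l) = 2 ^ L)%N.
Proof. by move=> hl; rewrite -expnD subnKC. Qed.

Definition E1d (l L : nat) (hl : (l <= L)%N) : 'M[R]_(2 ^ L, 2 ^ l) :=
  castmx (pow2_split hl, muln1 _)
    ((1%:M : 'M_(2 ^ l)) *t (const_mx 1 : 'cV_(2 ^ (L - l)))).

Definition Edir (d l L : nat) (hl : (l <= L)%N) (k : 'I_d) :
    'M[R]_(nrow L k, nrow l k) :=
  (prol1d hl ^t k) *t E1d hl *t (prol1d hl ^t (d - k.+1)).

(* The library's \mxdiag only takes square blocks; this is its definition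
   verbatim for rectangular ones.  conform_mx 0 (Edir hl i) is Edir hl i,
   retyped along i = j. *)
Definition Emx (d l L : nat) (hl : (l <= L)%N) :
    'M[R]_(\sum_(k < d) nrow L k, \sum_(k < d) nrow l k) :=
  \mxblock_(i < d, j < d) (if i == j then conform_mx 0 (Edir hl i) else 0).

Definition Tmx (d l L : nat) (hl : (l <= L)%N) :
    'M[R]_(\sum_(k < d) nrow L k, \sum_(k < d) nrow l k) :=
  let r := (2 ^ (L - l))%N in (r%:R `^ (- (d%:R / 2))) *: Emx d hl.

End Multilevel.

(* Main.v *)
Require Import Defs.
From mathcomp Require Import all_boot all_order all_algebra.
From mathcomp Require Import reals exp.
From mathcomp Require Import mxtens.
From mathcomp Require Import ring zify.

Set Implicit Arguments.
Unset Strict Implicit.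
Unset Printing Implicit Defensive.

Import Order.TTheory GRing.Theory Num.Theory.
Local Open Scope ring_scope.

(** The matrix [prol1d] interpolates linearly: between two adjacent coarse nodes,
    the fine grid function has constant slope.  With r = 2 ^ (L - l), each of the
    r fine differences inside a coarse cell therefore equals 1 / r times the
    coarse difference across that cell.  As [E1d] copies each coarse cell value r
    times, this says
      diff1d L *m prol1d = r^-1 *: (E1d *m diff1d l)
    ([diff1d_prol1d]), the only place where the shape of the grids enters.

    In dimension d, write the d-th Kronecker power of [prol1d] with the factor
    of direction k singled out ([ntensmx_split]).  The mixed-product rule
    (A *t B) *m (C *t D) = (A *m C) *t (B *m D) lets [diffdir] act on that factor
    alone, so the one-dimensional identity holds in each direction with the same
    factor r^-1 ([diffdir_prol]).  Stacking the directions keeps it, because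
    [Emx] is block diagonal ([Emx_Dmx]).

    What remains is a scalar identity ([meshsize_scaling]): since
    h_L = h_l / r, the normalizations h_L^(d/2 - 1) and h_l^(1 - d/2) combine to
    r^(1 - d/2), and the factor r^-1 turns this into r^(- d/2). *)

(** * Casts, scaling and Kronecker powers *)

Section KroneckerPowers.
Variable R : comPzRingType.

(** Kronecker products are associative and unital only up to a cast of the
    dimensions; this lemma makes the choice of the cast proofs irrelevant, so
    that all casts may be gathered at the head of a term and then compared. *)
Lemma castmx_irr m n m' n' (em em' : m = m') (en en' : n = n') (A : 'M[R]_(m, n)) :
  castmx (em, en) A = castmx (em', en') A.
Proof. by rewrite (nat_irrelevance em em') (nat_irrelevance en en'). Qed.

Lemma mulmx_castr m n p p' (ep : p = p') (A : 'M[R]_(m, n)) (B : 'M[R]_(n, p)) :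
  A *m castmx (erefl, ep) B = castmx (erefl, ep) (A *m B).
Proof. by case: p' / ep. Qed.

Lemma castmxZ m n m' n' (em : m = m') (en : n = n') a (A : 'M[R]_(m, n)) :
  castmx (em, en) (a *: A) = a *: castmx (em, en) A.
Proof. by case: m' / em; case: n' / en. Qed.

Lemma mulmx_col_ext m n (A B : 'M[R]_(m, n)) :
  (forall v : 'cV_n, A *m v = B *m v) -> A = B.
Proof.
move=> AB; apply/matrixP => i j.
by have /colP/(_ i) := AB (delta_mx j 0); rewrite -!colE !mxE.
Qed.

Lemma mxcolZ q (p : 'I_q -> nat) n a (B : forall k, 'M[R]_(p k, n)) :
  \mxcol_k (a *: B k) = a *: \mxcol_k B k.
Proof. by apply/matrixP => i j; rewrite !mxE. Qed.

Lemma tensmx_castl m n m' n' p q (em : m = m') (en : n = n')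
    (A : 'M[R]_(m, n)) (B : 'M[R]_(p, q)) :
  castmx (em, en) A *t B =
  castmx (congr1 (muln^~ p) em, congr1 (muln^~ q) en) (A *t B).
Proof. by case: m' / em; case: n' / en. Qed.

Lemma tensmx_castr m n p q p' q' (ep : p = p') (eq_q : q = q')
    (A : 'M[R]_(m, n)) (B : 'M[R]_(p, q)) :
  A *t castmx (ep, eq_q) B =
  castmx (congr1 (muln m) ep, congr1 (muln n) eq_q) (A *t B).
Proof. by case: p' / ep; case: q' / eq_q. Qed.

Lemma tensmxZl m n p q a (A : 'M[R]_(m, n)) (B : 'M[R]_(p, q)) :
  (a *: A) *t B = a *: (A *t B).
Proof. by apply/matrixP => i j; rewrite !mxE mulrA. Qed.

Lemma tensmxZr m n p q a (A : 'M[R]_(m, n)) (B : 'M[R]_(p, q)) :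
  A *t (a *: B) = a *: (A *t B).
Proof. by apply/matrixP => i j; rewrite !mxE mulrCA. Qed.

Lemma tensmxA m n p q s t
    (A : 'M[R]_(m, n)) (B : 'M[R]_(p, q)) (C : 'M[R]_(s, t)) :
  A *t (B *t C) = castmx (esym (mulnA _ _ _), esym (mulnA _ _ _)) (A *t B *t C).
Proof.
apply/matrixP => i j.
case: (mxtens_indexP i) => i0 i'; case: (mxtens_indexP i') => i1 i2.
case: (mxtens_indexP j) => j0 j'; case: (mxtens_indexP j') => j1 j2.
have reidx a b c (x : 'I_a) (y : 'I_b) (z : 'I_c) (e : (a * (b * c) = a * b * c)%N) :
    cast_ord e (mxtens_index (x, mxtens_index (y, z))) =
    mxtens_index (mxtens_index (x, y), z).
  by apply: val_inj => /=; rewrite mulnDl mulnA addnA.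
by rewrite castmxE !reidx !tensmxE mulrA.
Qed.

Lemma ntensmx_mul m n p (A : 'M[R]_(m, n)) (B : 'M[R]_(n, p)) k :
  A ^t k *m B ^t k = (A *m B) ^t k.
Proof.
case: k => [|k]; first by rewrite !ntensmx0 mulmx1.
elim: k => [|k IH]; first by rewrite !ntensmx1.
by rewrite !ntensmxSS tensmx_mul IH.
Qed.

(** The power [A ^t 1] is [A] itself rather than [A *t 1], so the recursion holds
    at k = 0 only up to a cast. *)
Lemma ntensmxSl m n (A : 'M[R]_(m, n)) k :
  A ^t k.+1 = castmx (esym (expnS _ _), esym (expnS _ _)) (A *t A ^t k).
Proof.
case: k => [|k]; last by rewrite ntensmxSS castmx_id.
rewrite ntensmx0 ntensmx1 tens_mx_scalar scale1r castmx_comp.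
by rewrite (castmx_irr _ erefl _ erefl) castmx_id.
Qed.

(** Isolates the factor on which the difference operator of direction k acts;
    the casts are those of [diffdir], so that they cancel in products. *)
Lemma ntensmx_split m n (A : 'M[R]_(m, n)) d (k : 'I_d) :
  A ^t d = castmx (dir_size m k, dir_size n k)
             (A ^t k *t A *t A ^t (d - k.+1)).
Proof.
(* The exponent d - k.+1 hides the relation between the three factors;
   with the numbers of factors on the two sides as independent variables,
   induction on the left one goes through. *)
suff H i j (em : (m ^ i * m * m ^ j = m ^ (i + j.+1))%N) en :
    A ^t (i + j.+1) = castmx (em, en) (A ^t i *t A *t A ^t j).
  case: k => k /= ltkd.
  have dE : d = (k + (d - k.+1).+1)%N by rewrite addnS -addSn subnKC.
  move: (dir_size _ _) (dir_size _ _) => /=.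
  move: (d - k.+1)%N dE => j dE; subst d => em en; exact: H.
elim: i em en => [|i IH] em en.
  rewrite ntensmx0 tens_scalar1mx tensmx_castl castmx_comp ntensmxSl.
  exact: castmx_irr.
have size_split b : (b ^ i * b * b ^ j = b ^ (i + j.+1))%N.
  by rewrite -expnSr -expnD addSnnS.
change (i.+1 + j.+1)%N with (i + j.+1).+1 in em, en |- *.
rewrite ntensmxSl (ntensmxSl A i) (IH (size_split m) (size_split n)).
rewrite !(tensmx_castl, tensmx_castr, castmx_comp) !tensmxA.
rewrite !(tensmx_castl, tensmx_castr, castmx_comp); exact: castmx_irr.
Qed.

End KroneckerPowers.

(** * The one-dimensional commutation *)

Section OneDimension.
Variable R : realType.

(** The extension by 0 makes this hold at the two boundary nodes as well, so that
    the first and last cells need no separate treatment below. *)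
Lemma nodeval_prol1_even l (v : 'cV[R]_(nnode l)) q :
  (q <= 2 ^ l)%N -> nodeval (prol1 R l *m v) q.*2 = nodeval v q.
Proof.
move=> leq2l; case: (boolP ((0 < q) && (q <= nnode l))%N) => [|out].
  exact: prol1_even.
rewrite !nodeval_out //; move: out leq2l; rewrite /nnode ?expnS.
  by have := expn_gt0 2 l; lia.
by have := expn_gt0 2 l; lia.
Qed.

(** The fine cell [j, j + 1] is one half of the coarse cell [j./2, j./2 + 1], and
    the interpolant is affine on the latter. *)
Lemma nodeval_prol1_diff l (v : 'cV[R]_(nnode l)) j :
  (j < 2 ^ l.+1)%N ->
  nodeval (prol1 R l *m v) j.+1 - nodeval (prol1 R l *m v) j =
  2^-1 * (nodeval v j./2.+1 - nodeval v j./2).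
Proof.
rewrite expnS => ltj.
have half1 (x : R) : x = 2^-1 * (x + x) by field.
rewrite -{1 2}(odd_double_half j); case: (boolP (odd j)) => oddj /=.
  rewrite add1n -doubleS nodeval_prol1_even; last by lia.
  have -> : (j./2.*2.+1 = j./2.+1.*2.-1)%N by lia.
  rewrite prol1_odd; last by lia.
  by rewrite /= {1}(half1 (nodeval v j./2.+1)); ring.
rewrite add0n nodeval_prol1_even; last by lia.
have -> : (j./2.*2.+1 = j./2.+1.*2.-1)%N by lia.
rewrite prol1_odd; last by lia.
by rewrite /= {2}(half1 (nodeval v j./2)); ring.
Qed.

(** Each refinement cuts every cell, and the difference across it, in two; after
    k of them the fine cell j lies in the coarse cell [j %/ 2 ^ k]. *)
Lemma nodeval_prolk_diff l k (v : 'cV[R]_(nnode l)) j :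
  (j < 2 ^ (k + l))%N ->
  nodeval (prolk R l k *m v) j.+1 - nodeval (prolk R l k *m v) j =
  (2 ^+ k)^-1 * (nodeval v (j %/ 2 ^ k).+1 - nodeval v (j %/ 2 ^ k)).
Proof.
elim: k j => [|k IH] j ltj.
  by rewrite /= mul1mx expr0 invr1 mul1r expn0 divn1.
rewrite /= -mulmxA nodeval_prol1_diff ?IH //.
  by rewrite -divn2 -divnMA -expnS mulrA exprS invfM.
by move: ltj; rewrite addSn expnS; lia.
Qed.

Lemma nodeval_prol1d_diff l L (hl : (l <= L)%N) (v : 'cV[R]_(nnode l)) j :
  (j < 2 ^ L)%N ->
  nodeval (prol1d R hl *m v) j.+1 - nodeval (prol1d R hl *m v) j =
  (2 ^+ (L - l))^-1 *
    (nodeval v (j %/ 2 ^ (L - l)).+1 - nodeval v (j %/ 2 ^ (L - l))).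
Proof.
have node_cast m e (A : 'M[R]_(m, nnode l)) q :
    nodeval (castmx (e : m = nnode L, erefl) A *m v) q = nodeval (A *m v) q.
  by case: _ / e.
by move=> ltj; rewrite !node_cast -nodeval_prolk_diff // subnK.
Qed.

Lemma E1dE l L (hl : (l <= L)%N) i j :
  E1d R hl i j = ((j : nat) == (i %/ 2 ^ (L - l))%N)%:R.
Proof. by rewrite castmxE !mxE mulr1 eq_sym -val_eqE /= divn1. Qed.

Lemma mul_E1d l L (hl : (l <= L)%N) (w : 'cV[R]_(2 ^ l))
    (i : 'I_(2 ^ L)) (j : 'I_(2 ^ l)) :
  (j : nat) = (i %/ 2 ^ (L - l))%N -> (E1d R hl *m w) i 0 = w j 0.
Proof.
move=> jE; rewrite mxE (bigD1 j) //= E1dE jE eqxx mul1r big1 ?addr0 // => k.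
by rewrite -val_eqE E1dE -jE => /negPf /= ->; rewrite mul0r.
Qed.

(** Both sides are compared on grid functions, where the differences are those
    of the node values extended by 0. *)
Lemma diff1d_prol1d l L (hl : (l <= L)%N) :
  diff1d R L *m prol1d R hl =
  (2 ^+ (L - l))^-1 *: (E1d R hl *m diff1d R l).
Proof.
apply: mulmx_col_ext => v; apply/colP => j.
have ltj : (j %/ 2 ^ (L - l) < 2 ^ l)%N.
  by rewrite ltn_divLR ?expn_gt0 // -expnD subnKC.
rewrite -mulmxA diff1dP nodeval_prol1d_diff // -scalemxAl -mulmxA mxE.
by rewrite (mul_E1d hl (diff1d R l *m v) (j := Ordinal ltj)) ?diff1dP.
Qed.

End OneDimension.

(** * All directions, and the scaling *)

Section Assembly.
Variable R : realType.

(** In the directions other than k, the identity commutes with [prol1d]; in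
    direction k the one-dimensional commutation applies. *)
Lemma diffdir_prol d l L (hl : (l <= L)%N) (k : 'I_d) :
  diffdir R L k *m prol1d R hl ^t d =
  (2 ^+ (L - l))^-1 *: (Edir R hl k *m diffdir R l k).
Proof.
rewrite /diffdir (ntensmx_split (prol1d R hl) k) mulmx_cast castmx_comp.
rewrite castmx_id mulmx_castr !tensmx_mul !ntensmx_mul !mul1mx diff1d_prol1d.
rewrite tensmxZr tensmxZl castmxZ; congr (_ *: _).
rewrite /Edir mulmx_castr !tensmx_mul !ntensmx_mul.
by rewrite !mulmx1.
Qed.

Lemma Emx_Dmx d l L (hl : (l <= L)%N) :
  Emx R d hl *m Dmx R d l = \mxcol_(k < d) (Edir R hl k *m diffdir R l k).
Proof.
rewrite mul_mxblock_mxrow; apply/eq_mxcol => k.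
rewrite (bigD1 k) //= eqxx conform_mx_id big1 ?addr0 // => j.
by rewrite eq_sym => /negPf ->; rewrite mul0mx.
Qed.

Lemma meshsize_scaling d l L : (l <= L)%N ->
  meshsize R L `^ (d%:R / 2 - 1) * meshsize R l `^ ((2 - d%:R) / 2)
    * (2 ^+ (L - l))^-1 = ((2 ^ (L - l))%N%:R : R) `^ (- (d%:R / 2)).
Proof.
move=> hl; set x := d%:R / 2 - 1.
have -> : (2 - d%:R) / 2 = - x by rewrite /x; field.
have -> : - (d%:R / 2) = - x + - 1 by rewrite /x; ring.
clearbody x.
(* The identity now holds for every real exponent x. *)
have meshL : meshsize R L = meshsize R l * (2 ^+ (L - l))^-1.
  by rewrite /meshsize -invfM -exprD subnKC.
have pos n : 0 < (2 ^+ n : R) by rewrite exprn_gt0.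
have mesh_gt0 : 0 < meshsize R l by rewrite invr_gt0.
have inv_gt0 : 0 < (2 ^+ (L - l) : R)^-1 by rewrite invr_gt0.
rewrite natrX meshL powRM ?ltW // [_ * _ * _ `^ (- x)]mulrAC -powRD; last first.
  by rewrite (gt_eqF mesh_gt0) implybT.
rewrite subrr powRr0 mul1r powRD; last by rewrite (gt_eqF (pos _)) implybT.
by rewrite -[- x]mulN1r powRrM !powR_inv1 ?ltW.
Qed.

End Assembly.

Theorem theorem4p1 (R : realType) (d l L : nat) (hd : (1 <= d)%N)
    (hl : (l <= L)%N) :
  Cmx R d L *m Smx R d hl = Tmx R d hl *m Dmx R d l.
Proof.
rewrite /Cmx /Smx /Tmx -!scalemxAl -scalemxAr Emx_Dmx -meshsize_scaling //.
rewrite scalerA -[RHS]scalerA; congr (_ *: _).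
rewrite /Dmx mxcol_mul -mxcolZ; apply/eq_mxcol => k.
exact: diffdir_prol.
Qed.
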